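(* Let $\lambda$ be a limit ordinal, let $L$ be a set of formulas and let $\mathcal F$ be a class of Kripke frames. If $L$ is characterized by $\mathcal F$ and $\lambda$-tail-sound for $\mathcal F$, then for every formula $\varphi$ the following four conditions are equivalent. (1) $\varphi\in\mathbf{D}^2[L]$. (2) $\varphi\in\mathbf{D}^3[L]$. (3) $\varphi$ is true at the bottom of any constant $\lambda$-extension of any $\mathcal F$-model. (4) $\varphi$ is true at the bottom of any $\lambda$-extension of any $\mathcal F$-model.
   Context: Formulas are built from propositional variables (the set of which is PropVar) and $\bot$ by $\to$ and $\Box$; other connectives are the usual classical abbreviations; the empty conjunction is $\top$ and the empty disjunction is $\bot$. $\mathbf{Form}$ is the set of formulas, $\mathbf{Taut}$ the set of tautologies. $\Gamma,\Delta$ denote finite sets of formulas; commas denote union; $\Box\Gamma=\{\Box\gamma\mid\gamma\in\Gamma\}$. For a set $L$ of formulas, $\mathrm{MP}[L]$ is the smallest set of formulas containing $L$ and closed under modus ponens, and $\mathbf{S}[L]=\mathrm{MP}[L\cup\{\Box\varphi\to\varphi\mid\varphi\in\mathbf{Form}\}]$; $\mathbf{D}^2[L]=\mathrm{MP}[\mathbf{Taut}\cup\{\bigwedge\Box\Gamma\to\bigvee\Box\Delta\mid \bigwedge(\Gamma,\Box\Gamma)\to\bigvee\Box\Delta\in L\}]$; $\mathbf{D}^3[L]=\mathrm{MP}[\mathbf{Taut}\cup\{\bigwedge\Box\Gamma\to\bigvee\Box\Delta\mid \bigwedge\Box\Gamma\to\bigvee\Box\Delta\in\mathbf{S}[L]\}]$.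 A Kripke model $\langle W,\prec,V\rangle$ consists of a non-empty set $W$, a relation $\prec\subseteq W\times W$ and $V:W\times\mathrm{PropVar}\to\{\mathsf{true},\mathsf{false}\}$, extended to all formulas as usual, with $V(w,\Box\varphi)=\mathsf{true}$ iff $V(w',\varphi)=\mathsf{true}$ for all $w'$ with $w\prec w'$. An $\mathcal F$-model is a Kripke model based on a frame in $\mathcal F$. $L$ is characterized by $\mathcal F$ if for every formula $\varphi$: $\varphi\in L$ iff $\varphi$ is true at any world of any $\mathcal F$-model. For a limit ordinal $\lambda$, $\langle W^+,\prec^+\rangle$ is a $\lambda$-extension of $\langle W,\prec\rangle$ if for some $t_0\in W$: $W^+=W\uplus\{t_\alpha\mid 0<\alpha\le\lambda\}$ (disjoint union, the $t_\alpha$ distinct) and $\prec^+ = \prec\cup\{(t_\alpha,t_\beta)\mid 0\le\beta<\alpha\le\lambda\}\cup\{(t_\alpha,x)\mid 0<\alpha\le\lambda,\ t_0\prec x\}$. The set $\{t_\alpha\mid0<\alpha<\lambda\}$ is the tail and $t_\lambda$ is the bottom. A model $\langle W^+,\prec^+,V^+\rangle$ is a $\lambda$-extension of $\langle W,\prec,V\rangle$ if its frame is a $\lambda$-extension of $\langle W,\prec\rangle$ and $V^+$ coincides with $V$ on $W$. It is constant if $V^+(t_\alpha,p)=V^+(t_\beta,p)$ for all $p\in\mathrm{PropVar}$ and all $\alpha,\beta<\lambda$ (including index $0$). A formula $\varphi$ is eventually always true in the tail if there is $\alpha<\lambda$ such that $\varphi$ is true at $t_\beta$ for all $\beta$ with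 $\alpha<\beta<\lambda$. $L$ is $\lambda$-tail-sound for $\mathcal F$ if any formula in $L$ is eventually always true in the tail of any $\lambda$-extension of any $\mathcal F$-model. *)

(* Defs.v *)
From HB Require Import structures.
From mathcomp Require Import all_boot all_order finmap.
From mathcomp Require Import boolp classical_sets.

Set Implicit Arguments.
Unset Strict Implicit.
Unset Printing Implicit Defensive.

Local Open Scope classical_set_scope.

(** * Formulas *)

Inductive form (PropVar : Type) : Type :=
| Var of PropVar
| Bot
| Imp of form PropVar & form PropVar
| Box of form PropVar.

Arguments Bot {PropVar}.

(* A choiceType structure on formulas, needed to form {fset form PropVar}. *)
Section FormChoice.
Variable PropVar : choiceType.

Fixpoint form_encode (phi : form PropVar) : GenTree.tree PropVar :=
  match phi with
  | Var p => GenTree.Leaf p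
  | Bot => GenTree.Node 0 [::]
  | Imp phi psi => GenTree.Node 1 [:: form_encode phi; form_encode psi]
  | Box phi => GenTree.Node 2 [:: form_encode phi]
  end.

Fixpoint form_decode (t : GenTree.tree PropVar) : option (form PropVar) :=
  match t with
  | GenTree.Leaf p => Some (Var p)
  | GenTree.Node 0 [::] => Some Bot
  | GenTree.Node 1 [:: t1; t2] =>
      if form_decode t1 is Some phi then
        if form_decode t2 is Some psi then Some (Imp phi psi) else None
      else None
  | GenTree.Node 2 [:: t1] =>
      if form_decode t1 is Some phi then Some (Box phi) else None
  | _ => None
  end.

Lemma form_encodeK : pcancel form_encode form_decode.
Proof. by elim=> [p||phi /= -> psi -> //|phi /= ->]. Qed.

HB.instance Definition _ := Choice.copy (form PropVar) (pcan_type form_encodeK).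

End FormChoice.

Section Connectives.
Variable PropVar : choiceType.
Implicit Types (phi psi : form PropVar) (G : {fset form PropVar}).

Definition Neg phi := Imp phi Bot.
Definition Top : form PropVar := Neg Bot.
Definition Or phi psi := Imp (Neg phi) psi.
Definition And phi psi := Neg (Imp phi (Neg psi)).

(* Finite sets are enumerated in the canonical order of {fset _}; the fold ends
   in Top (resp. Bot), so that the conjunction of {phi} is And phi Top. *)
Definition BigAnd G : form PropVar := \big[And/Top]_(phi <- G) phi.
Definition BigOr G : form PropVar := \big[Or/Bot]_(phi <- G) phi.

Definition Boxes G : {fset form PropVar} := [fset Box phi | phi in G]%fset.

(* Boolean evaluation, boxed formulas being treated as additional atoms. *)
Fixpoint bool_eval (v : PropVar -> bool) (b : form PropVar -> bool)
    (phi : form PropVar) : bool :=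
  match phi with
  | Var p => v p
  | Bot => false
  | Imp psi chi => bool_eval v b psi ==> bool_eval v b chi
  | Box psi => b psi
  end.

Definition Taut : set (form PropVar) :=
  [set phi | forall v b, bool_eval v b phi].

End Connectives.

Arguments Top {PropVar}.
Arguments Taut {PropVar}.

(** * The operators MP, S, D^2, D^3 *)

Section Operators.
Variable PropVar : choiceType.

Inductive MP (L : set (form PropVar)) : set (form PropVar) :=
| MP_incl phi : L phi -> MP L phi
| MP_mp phi psi : MP L phi -> MP L (Imp phi psi) -> MP L psi.

Definition S_of (L : set (form PropVar)) : set (form PropVar) :=
  MP (L `|` [set Imp (Box phi) phi | phi in [set: form PropVar]]).

Definition D2_of (L : set (form PropVar)) : set (form PropVar) :=
  MP (Taut `|`
    [set phi | exists G D : {fset form PropVar},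
       L (Imp (BigAnd (G `|` Boxes G)%fset) (BigOr (Boxes D))) /\
       phi = Imp (BigAnd (Boxes G)) (BigOr (Boxes D))]).

Definition D3_of (L : set (form PropVar)) : set (form PropVar) :=
  MP (Taut `|`
    [set phi | exists G D : {fset form PropVar},
       S_of L (Imp (BigAnd (Boxes G)) (BigOr (Boxes D))) /\
       phi = Imp (BigAnd (Boxes G)) (BigOr (Boxes D))]).

End Operators.

(** * Kripke semantics *)

Record kripke_frame := KripkeFrame {
  world :> Type;
  access : world -> world -> Prop;
  world_inhabited : inhabited world }.

Definition valuation (PropVar : Type) (X : kripke_frame) :=
  X -> PropVar -> bool.

Fixpoint truth (PropVar : Type) (X : kripke_frame) (V : valuation PropVar X)
    (w : X) (phi : form PropVar) : Prop :=
  match phi with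
  | Var p => V w p
  | Bot => False
  | Imp psi chi => truth V w psi -> truth V w chi
  | Box psi => forall w', access w w' -> truth V w' psi
  end.

Definition characterized (PropVar : choiceType) (L : set (form PropVar))
    (F : kripke_frame -> Prop) : Prop :=
  forall phi, L phi <->
    forall X, F X -> forall (V : valuation PropVar X) (w : X), truth V w phi.

(** * lambda-extensions *)

(* A limit ordinal is represented by a well-ordered type, whose elements play
   the role of the ordinals alpha < lambda: \bot is the ordinal 0, and having
   no greatest element says that lambda is neither 0 nor a successor. *)
Definition limit_ordinal (d : Order.disp_t) (lambda : bOrderType d) : Prop :=
  well_founded (fun a b : lambda => (a < b)%O) /\
  (forall a : lambda, exists b, (a < b)%O).

Section Extension.
Variables (d : Order.disp_t) (lambda : bOrderType d).

(* The ordinals alpha <= lambda: Some a is a < lambda, None is lambda. *)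
Definition index := option lambda.

Definition index_zero : index := Some \bot%O.

Definition index_lt (b a : index) : bool :=
  match b, a with
  | Some b', Some a' => (b' < a')%O
  | Some _, None => true
  | None, _ => false
  end.

Definition pos_index := {a : index | index_lt index_zero a}.

Variables (X : kripke_frame) (t0 : X).

Definition ext_world : Type := (X + pos_index)%type.

(* The point t_alpha, for all 0 <= alpha <= lambda. *)
Definition tpoint (a : index) : ext_world :=
  if insub a is Some u then inr (u : pos_index) else inl t0.

Definition ext_access (u v : ext_world) : Prop :=
  [\/ exists x y : X, [/\ access x y, u = inl x & v = inl y],
      exists b a : index, [/\ index_lt b a, u = tpoint a & v = tpoint b]
    | exists (a : index) (x : X),
        [/\ index_lt index_zero a, access t0 x, u = tpoint a & v = inl x]].

Definition ext_frame : kripke_frame :=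
  KripkeFrame ext_access (inhabits (inl t0)).

Definition tail_point (a : lambda) : ext_frame := tpoint (Some a).
Definition bottom : ext_frame := tpoint None.

Variable PropVar : choiceType.

Definition extends (V : valuation PropVar X)
    (Vp : valuation PropVar ext_frame) : Prop :=
  forall (w : X) (p : PropVar), Vp (inl w) p = V w p.

(* The index 0 is included: tail_point \bot is t_0. *)
Definition constant_ext (Vp : valuation PropVar ext_frame) : Prop :=
  forall (p : PropVar) (a b : lambda), Vp (tail_point a) p = Vp (tail_point b) p.

Definition eventually_in_tail (Vp : valuation PropVar ext_frame)
    (phi : form PropVar) : Prop :=
  exists a : lambda, forall b : lambda, (a < b)%O -> truth Vp (tail_point b) phi.

End Extension.

Arguments bottom {d} lambda {X} t0.

Definition tail_sound (d : Order.disp_t) (lambda : bOrderType d)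
    (PropVar : choiceType) (L : set (form PropVar)) (F : kripke_frame -> Prop) :
    Prop :=
  forall phi, L phi ->
  forall X, F X -> forall (V : valuation PropVar X) (t0 : X)
    (Vp : valuation PropVar (ext_frame lambda t0)),
  extends V Vp -> eventually_in_tail Vp phi.

(* Main.v *)
Require Import Defs.
From HB Require Import structures.
From mathcomp Require Import all_boot all_order finmap.
From mathcomp Require Import boolp classical_sets.

Import Order.TTheory.

(* (2) => (4): along the tail the truth of a box can only be lost, so, the tail
   having no last point, every reflection instance [Box f -> f] is eventually
   true there; hence so is all of S[L], by tail-soundness.  A box is true at the
   bottom iff it is true in the whole tail, which transfers the generators of
   D^3[L] from the tail to the bottom.
   (3) => (1): decide the boxed subformulas of phi as true (G) or false (D).  If
   [G, Box G -> \/ Box D] is not in L, refute it at a point t0 of an F-model;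
   in the constant extension from t0 the subformulas of phi do not change their
   truth value along the tail, so the bottom realises the given decision with
   any valuation of the variables, and phi follows from that decision by (3).
   Otherwise D^2[L] excludes the decision.  Either way
   [/\ Box G -> phi \/ \/ Box D] is in D^2[L]; combining all decisions gives
   phi. *)

(** * Boolean evaluation and truth of finite conjunctions and disjunctions *)

Lemma bool_eval_BigAnd (PropVar : choiceType) v b (G : {fset form PropVar}) :
  bool_eval v b (BigAnd G) = all (bool_eval v b) G.
Proof.
rewrite /BigAnd; elim: (enum_fset G) => [|x s IHs]; first by rewrite big_nil.
by rewrite big_cons /= IHs; case: bool_eval; case: all.
Qed.

Lemma bool_eval_BigOr (PropVar : choiceType) v b (G : {fset form PropVar}) :
  bool_eval v b (BigOr G) = has (bool_eval v b) G.
Proof.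
rewrite /BigOr; elim: (enum_fset G) => [|x s IHs]; first by rewrite big_nil.
by rewrite big_cons /= IHs; case: bool_eval; case: has.
Qed.

Lemma bool_eval_BigAnd_Boxes (PropVar : choiceType) v b
    (G : {fset form PropVar}) :
  bool_eval v b (BigAnd (Boxes G)) = all b G.
Proof.
rewrite bool_eval_BigAnd; apply/allP/allP => [H x xG|H _ /imfsetP[x /= xG ->]].
  by apply: (H (Box x)); apply: in_imfset.
exact: H.
Qed.

Lemma bool_eval_BigOr_Boxes (PropVar : choiceType) v b
    (G : {fset form PropVar}) :
  bool_eval v b (BigOr (Boxes G)) = has b G.
Proof.
rewrite bool_eval_BigOr; apply/hasP/hasP => [[_ /imfsetP[x /= xG ->] bx]|[x xG bx]].
  by exists x.
by exists (Box x) => //; apply: in_imfset.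
Qed.

(** A world sees its boxed formulas as atoms. This makes tautologies true everywhere and reduces the
    big connectives to boolean computations. *)
Lemma truth_bool_eval {PropVar : choiceType} {X : kripke_frame}
    (V : valuation PropVar X) w phi :
  truth V w phi <-> bool_eval (V w) (fun psi => `[< truth V w (Box psi) >]) phi.
Proof.
elim: phi => [p||f IHf g IHg|f _] //=.
- by rewrite IHf IHg; split=> [H|/implyP//]; apply/implyP.
- by split=> [H|/asboolP//]; apply/asboolP.
Qed.

Lemma truth_Taut {PropVar : choiceType} {X : kripke_frame}
    (V : valuation PropVar X) w phi : Taut phi -> truth V w phi.
Proof. by move=> H; apply/truth_bool_eval/H. Qed.

Lemma truth_BigAnd_Boxes {PropVar : choiceType} {X : kripke_frame}
    (V : valuation PropVar X) w (G : {fset form PropVar}) :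
  truth V w (BigAnd (Boxes G)) <-> forall f, f \in G -> truth V w (Box f).
Proof.
rewrite truth_bool_eval bool_eval_BigAnd_Boxes; split.
  by move/allP => H f /H /asboolP.
by move=> H; apply/allP => f /H ?; apply/asboolP.
Qed.

Lemma truth_BigOr_Boxes {PropVar : choiceType} {X : kripke_frame}
    (V : valuation PropVar X) w (G : {fset form PropVar}) :
  truth V w (BigOr (Boxes G)) <-> exists2 f, f \in G & truth V w (Box f).
Proof.
rewrite truth_bool_eval bool_eval_BigOr_Boxes; split.
  by move/hasP => [f fG /asboolP ?]; exists f.
by move=> [f fG ?]; apply/hasP; exists f => //; apply/asboolP.
Qed.

(** * Propositional reasoning under modus ponens, and the inclusion of [D2_of] in [D3_of] *)

Lemma MP_Taut1 {PropVar : choiceType} (A : set (form PropVar)) f g :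
  (forall h, Taut h -> MP A h) -> Taut (Imp f g) -> MP A f -> MP A g.
Proof. by move=> AT fg Af; apply: MP_mp Af (AT _ fg). Qed.

Lemma MP_Taut2 {PropVar : choiceType} (A : set (form PropVar)) f g h :
  (forall h, Taut h -> MP A h) -> Taut (Imp f (Imp g h)) ->
  MP A f -> MP A g -> MP A h.
Proof. by move=> AT fgh Af Ag; apply: MP_mp Ag (MP_mp Af (AT _ fgh)). Qed.

Lemma MP_sub_MP {PropVar : choiceType} (A B : set (form PropVar)) f :
  (forall g, A g -> MP B g) -> MP A f -> MP B f.
Proof. by move=> AB; elim=> [g /AB//|g h _ Bg _]; apply: MP_mp Bg. Qed.

(** In [S_of L] reflection turns each [Box g] with [g] in [G] into [g], so the boxes of [G] alone
    yield the whole premise of the clause in [L]. *)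
Lemma D2_sub_D3 {PropVar : choiceType} (L : set (form PropVar)) f :
  (forall g, Taut g -> L g) -> D2_of L f -> D3_of L f.
Proof.
move=> TL; apply: MP_sub_MP => g [Tg|[G [D [LGD ->]]]]; first by apply: MP_incl; left.
apply: MP_incl; right; exists G, D; split=> //.
have ST h : Taut h -> S_of L h by move=> /TL ?; apply: MP_incl; left.
(* The finitely many reflection instances needed, gathered into one formula so that a single
   tautology finishes the argument. *)
pose refl : form PropVar := \big[@And PropVar/Top]_(x <- G) Imp (Box x) x.
have : S_of L refl.
  rewrite /refl; elim: (enum_fset G) => [|x s IHs]; first by rewrite big_nil; apply: ST.
  rewrite big_cons; apply: (MP_Taut2 _ _ _ _ ST) IHs; last first.
    by apply: MP_incl; right; exists x.
  by move=> v b /=; do 2?[case: bool_eval]; case: (b x).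
have reflE v b : bool_eval v b refl = all (fun x => b x ==> bool_eval v b x) G.
  rewrite /refl; elim: (enum_fset G) => [|x s IHs]; first by rewrite big_nil.
  rewrite big_cons /= IHs; case: all; case: (b x) => //=; by case: bool_eval.
have SL : S_of L (Imp (BigAnd (G `|` Boxes G)%fset) (BigOr (Boxes D))).
  by apply: MP_incl; left.
move=> Sr; apply: (MP_Taut2 _ _ _ _ ST _ Sr SL) => v b.
rewrite [bool_eval _ _ _]/= reflE bool_eval_BigAnd_Boxes bool_eval_BigAnd.
apply/implyP => /allP H1; apply/implyP => H2; apply/implyP => /allP H3.
apply: (implyP H2); apply/allP => x; rewrite in_fsetU => /orP[xG|/imfsetP[y /= yG ->]].
  exact: implyP (H1 _ xG) (H3 _ xG).
exact: H3.
Qed.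

(** * Accessibility and truth in [lambda]-extensions *)

Lemma index_lt_trans {d : Order.disp_t} {lambda : bOrderType d}
    (a b c : Defs.index lambda) : index_lt a b -> index_lt b c -> index_lt a c.
Proof. by case: a b c => [a|] [b|] [c|] //=; apply: lt_trans. Qed.

Lemma index_lt_zeroF {d : Order.disp_t} {lambda : bOrderType d}
    (a b : Defs.index lambda) :
  ~~ index_lt (index_zero lambda) a -> index_lt b a = false.
Proof.
by case: a b => [a|] [b|] //=; rewrite lt0x negbK
  => /eqP ->; rewrite ltx0.
Qed.

Section ExtensionTruth.
Context {d : Order.disp_t} {lambda : bOrderType d} {X : kripke_frame} {t0 : X}.

Lemma tpoint_inl (a : Defs.index lambda) x :
  tpoint t0 a = inl x -> x = t0 /\ ~~ index_lt (index_zero lambda) a.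
Proof. by rewrite /tpoint; case: insubP => // na [->]. Qed.

Lemma tpoint_zero (a : Defs.index lambda) :
  ~~ index_lt (index_zero lambda) a -> tpoint t0 a = inl t0.
Proof. by rewrite /tpoint; case: insubP => // u ->. Qed.

Lemma tpoint_inj (a b : Defs.index lambda) : tpoint t0 a = tpoint t0 b ->
  index_lt (index_zero lambda) a -> a = b.
Proof.
rewrite /tpoint; case: insubP => [u _ ua|/negP//].
by case: insubP => // w _ wb [uw] _; rewrite -ua -wb uw.
Qed.

Lemma ext_access_inl x (v : ext_frame lambda t0) :
  access (inl x : ext_frame lambda t0) v <->
  exists2 y, access x y & v = inl y.
Proof.
split=> [[[x' [y [xy [->] ->]]]|[b [a [ba /esym/tpoint_inl[_ a0] _]]]
    |[a [y [a1 _ /esym/tpoint_inl[_ a0]]]]]|[y xy ->]].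
- by exists y.
- by rewrite index_lt_zeroF in ba.
- by rewrite a1 in a0.
- by constructor 1; exists x, y.
Qed.

(** Uniform in the index: for index 0 the first alternative is empty and the second gives the
    successors of [t0] in [X]. *)
Lemma ext_access_tpoint (a : Defs.index lambda) (v : ext_frame lambda t0) :
  access (tpoint t0 a : ext_frame lambda t0) v <->
  (exists2 b, index_lt b a & v = tpoint t0 b) \/
  (exists2 y, access t0 y & v = inl y).
Proof.
have [a0|a0] := boolP (index_lt (index_zero lambda) a); last first.
  rewrite tpoint_zero // ext_access_inl; split; first by right.
  by case=> // -[b]; rewrite index_lt_zeroF.
split=> [[[x [y [_ ax _]]]|[b [c [bc ac ->]]]|[c [y [_ ty ac ->]]]]|].
- by have [_] := tpoint_inl _ _ ax; rewrite a0.
- by left; exists b => //; rewrite (tpoint_inj _ _ ac a0).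
- by right; exists y.
- case=> [[b ba ->]|[y ty ->]]; first by constructor 2; exists b, a.
  by constructor 3; exists a, y.
Qed.

Context {PropVar : choiceType}.
Variables (V : valuation PropVar X) (Vp : valuation PropVar (ext_frame lambda t0)).

Lemma truth_inl : extends V Vp ->
  forall f x, truth Vp (inl x : ext_frame lambda t0) f <-> truth V x f.
Proof.
move=> VVp; elim=> [p||f IHf g IHg|f IHf] x //=.
- by rewrite VVp.
- by rewrite IHf IHg.
- split=> [H y xy|H w' /ext_access_inl[y xy ->]]; last by apply/IHf/H.
  by apply/IHf/H/ext_access_inl; exists y.
Qed.

(** The successors of [t0] are seen from every [tpoint], and [Box f] at [t0] accounts for all of
    them at once. *)
Lemma truth_Box_tpoint f (a : Defs.index lambda) :
  truth Vp (tpoint t0 a : ext_frame lambda t0) (Box f) <->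
  (forall b, index_lt b a -> truth Vp (tpoint t0 b : ext_frame lambda t0) f) /\
  truth Vp (inl t0 : ext_frame lambda t0) (Box f).
Proof.
split=> [H|[H1 H2] w /ext_access_tpoint[[b ba ->]|[y ty ->]]].
- split=> [b ba|w /ext_access_inl[y ty ->]]; apply/H/ext_access_tpoint.
    by left; exists b.
  by right; exists y.
- exact: H1.
- by apply/H2/ext_access_inl; exists y.
Qed.

Lemma truth_Box_anti f (a b : Defs.index lambda) : index_lt a b ->
  truth Vp (tpoint t0 b : ext_frame lambda t0) (Box f) ->
  truth Vp (tpoint t0 a : ext_frame lambda t0) (Box f).
Proof.
move=> ab /truth_Box_tpoint[H1 H2]; apply/truth_Box_tpoint; split=> // c ca.
exact/H1/(index_lt_trans _ _ _ ca ab).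
Qed.

Lemma eventually_mp f g : eventually_in_tail Vp f ->
  eventually_in_tail Vp (Imp f g) -> eventually_in_tail Vp g.
Proof.
move=> [a Ha] [b Hb]; exists (Order.max a b) => c.
by rewrite gt_max => /andP[/Ha Hf /Hb]; apply.
Qed.

(** Either [Box f] holds in the whole tail, and each tail point is seen from a later one, or it
    fails at some index and stays false from there on, making the implication vacuous. *)
Lemma eventually_reflection f : limit_ordinal lambda ->
  eventually_in_tail Vp (Imp (Box f) f).
Proof.
move=> [_ nomax].
have [H|] := EM (forall a : lambda, truth Vp (tail_point t0 a) (Box f)).
  exists \bot%O => b _ _; have [c bc] := nomax b.
  by have /truth_Box_tpoint[/(_ (Some b) bc)] := H c.
move/existsNP => [a na]; exists a => b ab Hb; case: na.
exact: (truth_Box_anti f (Some a) (Some b)).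
Qed.

Lemma eventually_S_of (L : set (form PropVar)) f : limit_ordinal lambda ->
  (forall g, L g -> eventually_in_tail Vp g) -> S_of L f ->
  eventually_in_tail Vp f.
Proof.
move=> lim HL; elim=> [g [/HL//|[h _ <-]]|g h _ Hg _]; last exact: eventually_mp.
exact: eventually_reflection.
Qed.

(** Were [Box f] not eventually false, it would by monotonicity hold in the whole tail, so [f] would
    hold at everything the bottom sees. *)
Lemma eventually_Neg_Box f : limit_ordinal lambda ->
  ~ truth Vp (bottom lambda t0) (Box f) ->
  eventually_in_tail Vp (Neg (Box f)).
Proof.
move=> [_ nomax] nb; apply: contrapT => ne; apply: nb; apply/truth_Box_tpoint.
have H (a : lambda) : truth Vp (tail_point t0 a) (Box f).
  apply: contrapT => na; apply: ne; exists a => b ab /= H; apply: na.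
  exact: (truth_Box_anti _ (Some a) (Some b)).
(* The tail point of index [\bot] is [t0] itself. *)
split=> [[a|//] _|]; last by have /truth_Box_tpoint[] := H \bot%O.
by have [c ac] := nomax a; have /truth_Box_tpoint[/(_ (Some a) ac)] := H c.
Qed.

Lemma eventually_all (s : seq (form PropVar)) :
  (forall f, f \in s -> eventually_in_tail Vp f) ->
  exists a : lambda, forall b : lambda, (a < b)%O ->
    forall f, f \in s -> truth Vp (tail_point t0 b) f.
Proof.
elim: s => [|f s IHs] Hs; first by exists \bot%O.
have [|a Ha] := IHs; first by move=> g gs; apply: Hs; rewrite inE gs orbT.
have [|c Hc] := Hs f; first by rewrite inE eqxx.
exists (Order.max a c) => b; rewrite gt_max => /andP[ab cb] g.
by rewrite inE => /orP[/eqP ->|gs]; [apply: Hc|apply: Ha].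
Qed.

(** If the conclusion failed at the bottom, each box of [D] would eventually be false in the tail,
    while the boxes of [G] are inherited by the whole tail; a late tail point then violates the
    implication. *)
Lemma bottom_generator (G D : {fset form PropVar}) : limit_ordinal lambda ->
  eventually_in_tail Vp (Imp (BigAnd (Boxes G)) (BigOr (Boxes D))) ->
  truth Vp (bottom lambda t0) (Imp (BigAnd (Boxes G)) (BigOr (Boxes D))).
Proof.
move=> lim evGD /truth_BigAnd_Boxes HG; apply: contrapT => nD.
(* One threshold serves both the implication and the negated boxes of [D]. *)
have [|a Ha] := eventually_all (Imp (BigAnd (Boxes G)) (BigOr (Boxes D))
                                 :: [seq Neg (Box f) | f <- enum_fset D]).
  move=> f; rewrite inE => /orP[/eqP ->//|/mapP[g gD ->]].
  apply: eventually_Neg_Box => // Hg; apply: nD.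
  by apply/truth_BigOr_Boxes; exists g.
have [b ab] := lim.2 a.
have /(Ha b ab _ (mem_head _ _))/truth_BigOr_Boxes[f fD] :
    truth Vp (tail_point t0 b) (BigAnd (Boxes G)).
  apply/truth_BigAnd_Boxes => f /HG.
  exact: (truth_Box_anti f (Some b) None).
apply: (Ha b ab (Neg (Box f))); rewrite inE; apply/orP; right.
exact: (map_f (fun g => Neg (Box g)) fD).
Qed.

Lemma bottom_D3_of (L : set (form PropVar)) f : limit_ordinal lambda ->
  (forall g, L g -> eventually_in_tail Vp g) -> D3_of L f ->
  truth Vp (bottom lambda t0) f.
Proof.
move=> lim HL; elim=> [g [/truth_Taut//|[G [D [SGD ->]]]]|g h _ Hg _]; last exact.
exact/bottom_generator/(eventually_S_of _ _ lim HL).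
Qed.

End ExtensionTruth.

(** * Boxed subformulas and constant extensions *)

Fixpoint boxed {PropVar : choiceType} (f : form PropVar) : seq (form PropVar) :=
  match f with
  | Var _ | Bot => [::]
  | Imp g h => boxed g ++ boxed h
  | Box g => g :: boxed g
  end.

Lemma bool_eval_ext {PropVar : choiceType} (v : PropVar -> bool) b b'
    (f : form PropVar) :
  {in boxed f, b =1 b'} -> bool_eval v b f = bool_eval v b' f.
Proof.
elim: f => [p||f IHf g IHg|f _] //= H; last by apply: H; rewrite inE eqxx.
by rewrite IHf ?IHg // => x xf; apply: H; rewrite mem_cat xf ?orbT.
Qed.

Section ConstantExtension.
Context {d : Order.disp_t} (lambda : bOrderType d) {X : kripke_frame}.
Context {PropVar : choiceType}.
Variables (V : valuation PropVar X) (t0 : X) (v : PropVar -> bool).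

(** Constancy only binds the indices below [lambda], so the variables at the bottom can be set
    freely by [v]. *)
Definition const_val : valuation PropVar (ext_frame lambda t0) :=
  fun u p => match u with
             | inl x => V x p
             | inr a => if sval a is Some _ then V t0 p else v p
             end.

Lemma const_val_extends : extends V const_val.
Proof. by []. Qed.

Lemma const_val_tail (a : lambda) p : const_val (tail_point t0 a) p = V t0 p.
Proof.
rewrite /tail_point /tpoint; case: insubP => // -[u u0] _ /= ua.
by rewrite ua.
Qed.

Lemma const_val_bottom p : const_val (bottom lambda t0) p = v p.
Proof. by rewrite /bottom /tpoint; case: insubP => // -[u u0] _ /= ->. Qed.

Lemma const_val_constant : constant_ext const_val.
Proof. by move=> p a b; rewrite !const_val_tail. Qed.

(** By induction on [f]. In the box case, reflection at [t0] gives the body at [t0], and the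
    induction hypothesis carries it to all earlier tail points. *)
Lemma truth_const_tail f :
  (forall g, g \in boxed f -> truth V t0 (Box g) -> truth V t0 g) ->
  forall a : lambda, truth const_val (tail_point t0 a) f <-> truth V t0 f.
Proof.
elim: f => [p||f IHf g IHg|f IHf] H a; first by rewrite /= const_val_tail.
- by [].
- have Hf x : x \in boxed f -> truth V t0 (Box x) -> truth V t0 x.
    by move=> xf; apply: H; rewrite /= mem_cat xf.
  have Hg x : x \in boxed g -> truth V t0 (Box x) -> truth V t0 x.
    by move=> xg; apply: H; rewrite /= mem_cat xg orbT.
  by rewrite /= (IHf Hf) (IHg Hg).
- rewrite truth_Box_tpoint (truth_inl _ _ const_val_extends).
  split=> [[]//|tf]; split=> // -[b|//] _; apply/IHf.
    by move=> g gf; apply: H; rewrite inE gf orbT.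
  by apply: H tf; rewrite inE eqxx.
Qed.

(** Restricted to boxes: these depend only on the points seen from the bottom, not on the valuation
    [v] there. *)
Lemma truth_const_bottom_Box f : limit_ordinal lambda ->
  (forall g, g \in boxed (Box f) -> truth V t0 (Box g) -> truth V t0 g) ->
  truth const_val (bottom lambda t0) (Box f) <-> truth V t0 (Box f).
Proof.
move=> lim H; have Hf g : g \in boxed f -> truth V t0 (Box g) -> truth V t0 g.
  by move=> gf; apply: H; rewrite inE gf orbT.
rewrite truth_Box_tpoint (truth_inl _ _ const_val_extends).
split=> [[]//|tf]; split=> // -[b|//] _; apply/(truth_const_tail _ Hf).
by apply: H tf; rewrite inE eqxx.
Qed.

End ConstantExtension.

(** * From truth at the bottom of constant extensions to membership in [D2_of] *)

Lemma boxed_trans {PropVar : choiceType} (f g h : form PropVar) :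
  g \in boxed f -> h \in boxed g -> h \in boxed f.
Proof.
elim: f => [p||f1 IH1 f2 IH2|f IHf] //=; rewrite ?mem_cat ?inE.
- by case/orP=> [/IH1 IH /IH ->//|/IH2 IH /IH ->]; rewrite orbT.
- by case/orP=> [/eqP -> ->|/IHf IH /IH ->]; rewrite orbT.
Qed.

(** By induction on [s], each formula is put either into [G] or into [D], and the two resulting
    clauses are cut on its box. *)
Lemma MP_case_boxes {PropVar : choiceType} (A : set (form PropVar)) f
    (s : seq (form PropVar)) :
  (forall h, Taut h -> MP A h) ->
  (forall G D : {fset form PropVar}, {subset s <= (G `|` D)%fset} ->
     MP A (Imp (BigAnd (Boxes G)) (Or f (BigOr (Boxes D))))) ->
  MP A f.
Proof.
move=> AT H.
(* With both sets empty the clause is equivalent to [f]; arbitrary sets let the induction add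
   decisions. *)
suff /(_ fset0 fset0) : forall G D : {fset form PropVar},
    MP A (Imp (BigAnd (Boxes G)) (Or f (BigOr (Boxes D)))).
  apply: (MP_Taut1 _ _ _ AT) => v b.
  rewrite [bool_eval _ _ _]/= bool_eval_BigAnd_Boxes bool_eval_BigOr_Boxes /=.
  by case: bool_eval.
elim: s H => [|x s IHs] H G D; first by apply: H.
apply: IHs => {}G {}D sGD.
have H1 := H (x |` G)%fset D; have H2 := H G (x |` D)%fset.
apply: (MP_Taut2 _ _ _ _ AT) (H1 _) (H2 _) => [v b|y|y].
- rewrite [bool_eval _ _ _]/= !bool_eval_BigAnd_Boxes !bool_eval_BigOr_Boxes.
  have -> : all b (x |` G)%fset = b x && all b G.
    apply/allP/andP => [Hb|[bx /allP bG] y].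
      split; first by apply: Hb; rewrite !inE eqxx.
      by apply/allP => y yG; apply: Hb; rewrite !inE yG orbT.
    by rewrite !inE => /orP[/eqP ->|/bG].
  have -> : has b (x |` D)%fset = b x || has b D.
    apply/hasP/orP => [[y]|[bx|/hasP[y yD ybx]]].
    - rewrite !inE => /orP[/eqP -> ?|yD yb]; [by left|by right; apply/hasP; exists y].
    - by exists x; rewrite // !inE eqxx.
    - by exists y; rewrite // !inE yD orbT.
  by case: (b x); case: bool_eval; case: all; case: has.
- rewrite !inE => /orP[->//|/sGD]; rewrite !inE => /orP[] ->; by rewrite ?orbT.
- rewrite !inE => /orP[->|/sGD]; first by rewrite orbT.
  by rewrite !inE => /orP[] ->; rewrite ?orbT.
Qed.

Lemma D2_of_bottom_constant {PropVar : choiceType} {d : Order.disp_t}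
    (lambda : bOrderType d) (L : set (form PropVar)) (F : kripke_frame -> Prop)
    f :
  limit_ordinal lambda -> characterized L F ->
  (forall X, F X -> forall (V : valuation PropVar X) (t0 : X)
     (Vp : valuation PropVar (ext_frame lambda t0)),
   extends V Vp -> constant_ext Vp -> truth Vp (bottom lambda t0) f) ->
  D2_of L f.
Proof.
move=> lim charL Hf.
have D2T h : Taut h -> D2_of L h by move=> ?; apply: MP_incl; left.
apply: (MP_case_boxes _ f (boxed f) D2T) => G D fGD.
pose clause := Imp (BigAnd (G `|` Boxes G)%fset) (BigOr (Boxes D)).
have [Lc|nLc] := EM (L clause).
  have : D2_of L (Imp (BigAnd (Boxes G)) (BigOr (Boxes D))).
    by apply: MP_incl; right; exists G, D.
  apply: (MP_Taut1 _ _ _ D2T) => w b /=.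
  by do 3?[case: bool_eval].
have [X [FX [V [t0 nc]]]] : exists X, F X /\
    exists (V : valuation PropVar X) t0, ~ truth V t0 clause.
  apply: contrapT => H; apply/nLc/charL => X FX V w; apply: contrapT => nw.
  by apply: H; exists X; split=> //; exists V, w.
have {nc} [tG tBG fBD] : [/\ forall g, g \in G -> truth V t0 g,
    forall g, g \in G -> truth V t0 (Box g) &
    forall g, g \in D -> ~ truth V t0 (Box g)].
  have /not_implyP[/truth_bool_eval tA nD] := nc.
  rewrite bool_eval_BigAnd in tA; split=> g gG.
  - by apply/truth_bool_eval/(allP tA); rewrite !inE gG.
  - apply/truth_bool_eval/(allP tA); rewrite in_fsetU; apply/orP; right.
    exact: in_imfset.
  - by move=> tg; apply: nD; apply/truth_BigOr_Boxes; exists g.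
(* In this case the clause is even a tautology: any evaluation respecting the decision is realised
   at a bottom. *)
apply: D2T => v b.
rewrite [bool_eval _ _ _]/= bool_eval_BigAnd_Boxes bool_eval_BigOr_Boxes.
apply/implyP => /allP bG; apply/implyP; rewrite implybF => nf; apply: contraT.
move=> /hasPn bD; case/negP: nf.
have := Hf X FX V t0 _ (const_val_extends lambda V t0 v)
  (const_val_constant lambda V t0 v).
rewrite truth_bool_eval.
(* Since the variables at the bottom agree with [v], it remains to compare [b] with the truth of the
   boxes there. *)
have -> : const_val lambda V t0 v (bottom lambda t0) = v.
  by apply: funext => p; apply: const_val_bottom.
rewrite (bool_eval_ext _ _ b) // => g gf.
(* If [h] is in [G] it is true at [t0]; if it is in [D] its box is false there. *)
have refl h : h \in boxed f -> truth V t0 (Box h) -> truth V t0 h.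
  by move=> /fGD; rewrite in_fsetU => /orP[/tG//|/fBD].
have reflg h : h \in boxed (Box g) -> truth V t0 (Box h) -> truth V t0 h.
  rewrite inE => /orP[/eqP ->|hg]; apply: refl => //; exact: boxed_trans gf hg.
have := truth_const_bottom_Box lambda V t0 v g lim reflg => tb.
have /fGD := gf; rewrite in_fsetU => /orP[gG|gD].
  by rewrite bG //; apply/asboolP/tb/tBG.
by rewrite (negbTE (bD _ gD)); apply/asboolP => /tb; apply: fBD.
Qed.

Theorem theorem7p4 (PropVar : choiceType)
    (d : Order.disp_t) (lambda : bOrderType d)
    (L : set (form PropVar)) (F : kripke_frame -> Prop) :
  limit_ordinal lambda ->
  characterized L F ->
  tail_sound lambda L F ->
  forall phi : form PropVar,
  [<-> D2_of L phi;
       D3_of L phi;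
       forall X, F X -> forall (V : valuation PropVar X) (t0 : X)
         (Vp : valuation PropVar (ext_frame lambda t0)),
       extends V Vp -> constant_ext Vp -> truth Vp (bottom lambda t0) phi;
       forall X, F X -> forall (V : valuation PropVar X) (t0 : X)
         (Vp : valuation PropVar (ext_frame lambda t0)),
       extends V Vp -> truth Vp (bottom lambda t0) phi].
Proof.
move=> lim charL sound phi.
have D23 : D2_of L phi -> D3_of L phi.
  (* Characterization by a class of frames puts all tautologies into [L]. *)
  apply: D2_sub_D3 => g Tg; apply/charL => X _ V w; exact: truth_Taut.
have D3bottom : D3_of L phi -> forall X, F X -> forall (V : valuation PropVar X)
    (t0 : X) (Vp : valuation PropVar (ext_frame lambda t0)),
    extends V Vp -> truth Vp (bottom lambda t0) phi.
  move=> D3 X FX V t0 Vp VVp; apply: (bottom_D3_of _ L) D3 => // g Lg.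
  exact: sound VVp.
have bottomD2 := D2_of_bottom_constant lambda L F phi lim charL.
tfae=> [//|D3 X FX V t0 Vp VVp _|Hc|H4].
- exact: D3bottom VVp.
(* Passing from constant to arbitrary extensions goes through (1) and (2). *)
- exact/D3bottom/D23/bottomD2.
- by apply: bottomD2 => X FX V t0 Vp VVp _; apply: H4 VVp.
Qed.
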